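(* Let $k\ge1$, $m\ge0$, $q\ge1$ be integers and for $(t,\eta)\in\mathbb{P}\times\mathbb{P}$ let $$f(t,\eta)=f_{m,k}(t,\eta)=\sum_{\deg Y\le k-1}\sum_{\deg Z\le m}E(tYZ)\sum_{\deg U\le 0}E(\eta YU).$$ Then $f(t,\eta)=2^{k+m+2-r(D^{[1;1+m]\times k}(t,\eta))}$ and $$\int_{\mathbb{P}}\int_{\mathbb{P}}f^q(t,\eta)\,dt\,d\eta=2^{q(k+m+2)-2k-m}\sum_{i=0}^{\min(k,2+m)}\Gamma_i^{[1;1+m]\times k}2^{-iq}.$$
   Context: $\mathbb{K}=\mathbb{F}_2((T^{-1}))$; $\mathbb{P}=\{\sum_{i\ge1}\alpha_iT^{-i}\}$ is the unit interval with Haar measure of total mass $1$. $E(t)=(-1)^{\alpha_1}$, $\alpha_1$ the coefficient of $T^{-1}$. Sums are over polynomials in $\mathbb{F}_2[T]$ with the given degree bounds (zero polynomial included). For $t=\sum\alpha_iT^{-i}$, $\eta=\sum\beta_iT^{-i}$, $D^{[1;1+m]\times k}(t,\eta)$ is the $(2+m)\times k$ matrix over $\mathbb{F}_2$ whose first $1+m$ rows are the persymmetric matrix $(\alpha_{i+j-1})_{1\le i\le 1+m,1\le j\le k}$ and whose last row is $(\beta_1,\dots,\beta_k)$; $r$ is rank over $\mathbb{F}_2$. $\Gamma_i^{[1;1+m]\times k}$ is the number of $(2+m)\times k$ matrices over $\mathbb{F}_2$ whose top $(1+m)\times k$ block is persymmetric and whose last row is arbitrary, having rank $i$. *)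

(* Defs.v *)
From HB Require Import structures.
From mathcomp Require Import all_boot all_order all_algebra.
From mathcomp Require Import all_classical all_reals all_analysis.

Set Implicit Arguments.
Unset Strict Implicit.
Unset Printing Implicit Defensive.

Import Order.TTheory GRing.Theory Num.Theory.

Local Open Scope classical_set_scope.
Local Open Scope ring_scope.

(** The field K = F_2((T^-1)): [lcoef x n] is the coefficient of T^n in x, so
    that the coefficient alpha_i of T^-i is [lcoef x (- i%:Z)]. *)
Record laurent := Laurent {
  lcoef :> int -> 'F_2;
  _ : exists N : int, forall n : int, N < n -> lcoef n = 0 }.

Lemma lcoef_bounded (x : laurent) :
  exists N : int, forall n : int, N < n -> x n = 0.
Proof. by case: x. Qed.

(** The Cauchy product. The sum over all i : int has finite support because
    both coefficient families vanish in large degree. *)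
Definition lmul_coef (x y : laurent) (n : int) : 'F_2 :=
  \sum_(i \in [set: int]) x i * y (n - i).

Lemma lmul_bounded (x y : laurent) :
  exists N : int, forall n : int, N < n -> lmul_coef x y n = 0.
Proof.
have [M xM] := lcoef_bounded x; have [N yN] := lcoef_bounded y.
exists (M + N) => n ltn; apply: fsbig1 => i _.
have [iM|Mi] := leP i M; last by rewrite xM ?mul0r.
rewrite [y _]yN ?mulr0// ltrBrDl.
by apply: le_lt_trans ltn; rewrite lerD2r.
Qed.

Definition lmul (x y : laurent) : laurent := Laurent (lmul_bounded x y).

Definition lpoly_coef (p : {poly 'F_2}) (n : int) : 'F_2 :=
  if n is Posz i then p`_i else 0.

Lemma lpoly_bounded (p : {poly 'F_2}) :
  exists N : int, forall n : int, N < n -> lpoly_coef p n = 0.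
Proof.
exists (size p)%:Z => -[i|i]//= ltpi.
by apply: nth_default; rewrite ltz_nat in ltpi; exact: ltnW.
Qed.

Definition lpoly (p : {poly 'F_2}) : laurent := Laurent (lpoly_bounded p).

(** The unit interval P: series involving only T^-1, T^-2, ... *)
Record unit_interval := UnitInterval {
  ui_val :> laurent;
  _ : forall n : int, 0 <= n -> ui_val n = 0 }.

Lemma ui_valP (t : unit_interval) (n : int) : 0 <= n -> t n = 0.
Proof. by case: t => x; exact. Qed.

Definition ui_coef (t : unit_interval) (i : nat) : 'F_2 := t (- i%:Z).

Lemma ui_add_bounded (t u : unit_interval) :
  exists N : int, forall n : int, N < n -> t n + u n = 0.
Proof. by exists 0 => n n0; rewrite !ui_valP ?addr0// ltW. Qed.

Lemma ui_addP (t u : unit_interval) (n : int) :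
  0 <= n -> Laurent (ui_add_bounded t u) n = 0.
Proof. by move=> n0 /=; rewrite !ui_valP ?addr0. Qed.

Definition ui_add (t u : unit_interval) : unit_interval :=
  UnitInterval (@ui_addP t u).

Lemma ui_zero_bounded :
  exists N : int, forall n : int, N < n -> (fun=> 0 : 'F_2) n = 0.
Proof. by exists 0. Qed.

Lemma ui_zeroP (n : int) : 0 <= n -> Laurent ui_zero_bounded n = 0.
Proof. by []. Qed.

Definition ui_zero : unit_interval := UnitInterval ui_zeroP.

HB.instance Definition _ := gen_eqMixin unit_interval.
HB.instance Definition _ := gen_choiceMixin unit_interval.
HB.instance Definition _ := isPointed.Build unit_interval ui_zero.

(** The topology of P is the one of the T^-1-adic valuation: u lies in
    [ui_ball t n] iff u - t has no term of degree >= -n. *)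
Definition ui_ball (t : unit_interval) (n : nat) : set unit_interval :=
  [set u | forall i, (i <= n)%N -> ui_coef u i = ui_coef t i].

Definition ui_open : set_system unit_interval :=
  [set U | forall t, U t -> exists n, ui_ball t n `<=` U].

Lemma ui_openT : ui_open setT.
Proof. by move=> t _; exists 0%N. Qed.

Lemma ui_openI : setI_closed ui_open.
Proof.
move=> U V oU oV t [/oU[m tU] /oV[n tV]]; exists (maxn m n) => u tu.
by split; [apply: tU|apply: tV] => i le_i; apply: tu;
  rewrite leq_max le_i ?orbT.
Qed.

Lemma ui_open_bigU (I : Type) (f : I -> set unit_interval) :
  (forall i, ui_open (f i)) -> ui_open (\bigcup_i f i).
Proof.
by move=> oF t [i _ /oF[n tf]]; exists n => u /tf fu; exists i.
Qed.

HB.instance Definition _ :=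
  isOpenTopological.Build unit_interval ui_openT ui_openI ui_open_bigU.

Notation borel_ui := (g_sigma_algebraType (@open unit_interval)).

(** The Haar measure of the compact group P with total mass 1: the
    translation-invariant Borel probability measure on P. *)
Definition is_haar (R : realType) (mu : {measure set borel_ui -> \bar R}) :=
  mu [set: borel_ui] = 1%E /\
  forall (t : unit_interval) (A : set borel_ui),
    measurable A -> mu (ui_add t @` A) = mu A.

Definition expE (R : realType) (x : laurent) : R := (-1) ^+ nat_of_ord (x (- 1)).

(** [{poly_n 'F_2}] is the finite type of polynomials of degree <= n - 1,
    zero included. *)
Definition fsum (R : realType) (m k : nat) (t eta : unit_interval) : R :=
  \sum_(Y : {poly_k 'F_2}) \sum_(Z : {poly_m.+1 'F_2})
    expE R (lmul (lmul t (lpoly Y)) (lpoly Z)) *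
    \sum_(U : {poly_1 'F_2}) expE R (lmul (lmul eta (lpoly Y)) (lpoly U)).

(** Ordinals start at 0, hence alpha_(i + j - 1) becomes alpha_(i + j + 1). *)
Definition Dmx (m k : nat) (t eta : unit_interval) : 'M['F_2]_(m.+1 + 1, k) :=
  col_mx (\matrix_(i < m.+1, j < k) ui_coef t (i + j).+1)
         (\row_(j < k) ui_coef eta j.+1).

Definition persymmetric (a b : nat) (A : 'M['F_2]_(a, b)) : bool :=
  [forall i : 'I_a, forall j : 'I_b, forall i' : 'I_a, forall j' : 'I_b,
     ((i + j)%N == (i' + j')%N) ==> (A i j == A i' j')].

Definition Gamma (m k i : nat) : nat :=
  #|[pred A : 'M['F_2]_(m.+1 + 1, k) |
       persymmetric (usubmx A) && (\rank A == i)]|.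

(* Main.v *)
(** The coefficient of T^-1 in [tYZ] is the bilinear form [z H y] in the
    coefficient vectors of Z and Y, where H is the Hankel block of the matrix D;
    likewise for [eta Y U] and the last row of D. Summing the signs over Z and U
    gives 2^(m+2) if [D y = 0] and 0 otherwise, and there are 2^(k - rank D)
    such y. Hence [f^q] depends only on the first k + m digits of t and the
    first k digits of eta. By translation invariance all cylinders fixing N
    digits have Haar measure 2^-N, so the integral is 2^-(2k+m) times a sum over
    all digit vectors, that is, over all matrices with a persymmetric top
    block; these are grouped by rank. *)

Require Import Defs.
From HB Require Import structures.
From mathcomp Require Import all_boot all_order all_algebra.
From mathcomp Require mxabelem.
From mathcomp Require Import all_classical all_reals all_analysis.
From mathcomp Require Import measurable_realfun zify.

Import Order.TTheory GRing.Theory Num.Theory.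

Local Open Scope classical_set_scope.
Local Open Scope ring_scope.

(** * Sign characters and kernels over F_2 *)

Definition sign2 (R : realType) (a : 'F_2) : R := (-1) ^+ nat_of_ord a.

Lemma sign2D (R : realType) (a b : 'F_2) :
  sign2 R (a + b) = sign2 R a * sign2 R b.
Proof.
by case: a b => [[|[|//]] ?] [[|[|//]] ?];
  rewrite /sign2 /= ?expr0 ?expr1 ?mulr1 ?mul1r ?mulrNN ?mulr1.
Qed.

Lemma F2_neq0 (a : 'F_2) : a != 0 -> a = 1.
Proof. by case: a => [[|[|//]] ?] // _; apply/val_inj. Qed.

(* If [v i 0 = 1], translating [w] by the i-th unit vector flips every sign. *)
Lemma sum_sign2_mulmx (R : realType) (n : nat) (v : 'cV['F_2]_n) :
  \sum_(w : 'rV['F_2]_n) sign2 R ((w *m v) 0 0) =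
  if v == 0 then 2%:R ^+ n else 0.
Proof.
have [->|v0] := eqVneq v 0.
  under eq_bigr do rewrite mulmx0 mxE /sign2 expr0.
  by rewrite sumr_const card_mx card_Fp// mul1n natrX.
have [i vi] : exists i, v i 0 = 1.
  have [i vi|v0'] := pickP (fun i => v i 0 != 0).
    by exists i; exact: F2_neq0.
  case/negP: v0; apply/eqP/colP => i; rewrite mxE.
  by have /negbFE/eqP := v0' i.
set S := LHS; have SN : S = - S.
  rewrite {1}/S (reindex_inj (addrI (delta_mx 0 i : 'rV['F_2]_n))) /= -sumrN.
  apply: eq_bigr => w _; rewrite mulmxDl mxE sign2D.
  rewrite -rowE mxE vi {1}/sign2 /=; exact: mulN1r.
by apply/eqP; rewrite -[_ == 0](mulrn_eq0 S 2) mulr2n {2}SN subrr.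
Qed.

Lemma card_kernel_trmx (m n : nat) (D : 'M['F_2]_(m, n)) :
  #|[pred y : 'rV['F_2]_n | D *m y^T == 0]| = (2 ^ (n - \rank D))%N.
Proof.
have := mxabelem.card_rowg (kermx D^T).
rewrite card_Fp// mxrank_ker mxrank_tr => <-; apply: eq_card => y.
rewrite mxabelem.mem_rowg inE; apply/eqP/sub_kermxP => /(congr1 trmx).
  by rewrite trmx_mul trmxK trmx0.
by rewrite trmx_mul trmxK trmx0.
Qed.

(** * Exponential sums as sums over vectors *)

Definition hankel (l k : nat) (t : unit_interval) : 'M['F_2]_(l, k) :=
  \matrix_(i < l, j < k) ui_coef t (i + j).+1.

Lemma Dmx_hankel (m k : nat) (t eta : unit_interval) :
  Dmx m k t eta = col_mx (hankel m.+1 k t) (hankel 1 k eta).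
Proof. by congr col_mx; apply/matrixP => i j; rewrite !mxE (ord1 i). Qed.

(** The substitution i -> n - i puts the summation index on the polynomial, whose coefficients
    vanish at negative indices and from l on. *)
Lemma lmul_lpoly (x : laurent) (p : {poly 'F_2}) (l : nat) (n : int) :
  (size p <= l)%N ->
  lmul x (lpoly p) n = \sum_(i < l) p`_i * x (n - i%:Z).
Proof.
move=> pl; rewrite /= /lmul_coef.
rewrite (reindex_fsbigT (fun i : int => n - i)); last first.
  by exists (fun i => n - i) => i; exact: subKr.
under eq_fsbigr do rewrite subKr.
rewrite (fsbig_ord _ _ (fun i : nat => p`_i * x (n - i%:Z))).
rewrite -(@fsbig_image _ _ _ nat int `I_l Posz
  (fun i : int => lpoly_coef p i * x (n - i))) /=; last by move=> i j _ _ [].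
apply/esym; under [RHS]eq_fsbigr do rewrite mulrC.
apply: fsbig_widen => // -[i|i] [_ /= il]; last by rewrite mul0r.
rewrite nth_default ?mul0r// (leq_trans pl)// leqNgt.
by apply/negP => lti; apply: il; exists i.
Qed.

(** Used with l = m + 1 for the persymmetric block of t, and with l = 1 for the last row of D, which
    is a one-row Hankel block of eta. *)
Lemma lmul_lpoly2 (t : unit_interval) (l k : nat)
    (Y : {poly_k 'F_2}) (Z : {poly_l 'F_2}) :
  lmul (lmul t (lpoly Y)) (lpoly Z) (- 1) =
  (npoly_rV Z *m (hankel l k t *m (npoly_rV Y)^T)) 0 0.
Proof.
rewrite (@lmul_lpoly _ _ l) ?size_npoly// mxE; apply: eq_bigr => i _.
rewrite (@lmul_lpoly _ _ k) ?size_npoly// !mxE; congr (_ * _).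
apply: eq_bigr => j _; rewrite !mxE mulrC; congr (_ * _).
by rewrite /ui_coef; congr (lcoef (ui_val t) _); rewrite -!opprD -!PoszD add1n.
Qed.

Lemma reindex_npoly (R : realType) (n : nat) (F : 'rV['F_2]_n -> R) :
  \sum_(p : {poly_n 'F_2}) F (npoly_rV p) = \sum_(v : 'rV['F_2]_n) F v.
Proof.
rewrite [RHS](reindex (@npoly_rV 'F_2 n))//=.
by exists (@rVnpoly _ _) => ? _; [exact: npoly_rV_K|exact: rVnpolyK].
Qed.

Lemma fsum_rank (R : realType) (m k : nat) (t eta : unit_interval) :
  fsum R m k t eta = 2%:R ^ ((k + m + 2)%:Z - (\rank (Dmx m k t eta))%:Z).
Proof.
transitivity (\sum_(y : 'rV['F_2]_k)
    if Dmx m k t eta *m y^T == 0 then 2%:R ^+ (m.+1 + 1) else 0 : R).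
  rewrite -reindex_npoly; apply: eq_bigr => Y _; rewrite -mulr_suml.
  rewrite Dmx_hankel mul_col_mx col_mx_eq0.
  under eq_bigr do rewrite /expE lmul_lpoly2.
  under [X in _ * X]eq_bigr do rewrite /expE lmul_lpoly2.
  rewrite (reindex_npoly _ _ (fun z => sign2 R ((z *m _) 0 0))).
  rewrite (reindex_npoly _ _ (fun z => sign2 R ((z *m _) 0 0))).
  rewrite !sum_sign2_mulmx exprD.
  by do 2!case: eqP => _; rewrite /= ?mul0r ?mulr0.
rewrite -big_mkcond sumr_const card_kernel_trmx -[LHS]mulr_natr natrX -exprD.
rewrite exprnP; congr (2%:R ^ _).
by rewrite PoszD -subzn ?rank_leq_col// addrA -PoszD; congr (Posz _ - _);
  rewrite addn1 addnC -addn2 addnA.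
Qed.

(** * Digits, cylinders and their Haar measure *)

Lemma ui_ext (t u : unit_interval) :
  (forall i, ui_coef t i.+1 = ui_coef u i.+1) -> t = u.
Proof.
case: t u => [[f fb] f0] [[g gb] g0]; rewrite /ui_coef /= => fg.
have efg : f = g.
  apply/funext => -[n|n]; first exact: etrans (f0 n isT) (esym (g0 n isT)).
  (* [Negz n] is convertible with the opposite of [n.+1]. *)
  exact: fg.
move: fb gb f0 g0; rewrite efg => fb gb; rewrite (Prop_irrelevance fb gb).
by move=> f0 g0; rewrite (Prop_irrelevance f0 g0).
Qed.

Lemma ui_coef_add (t u : unit_interval) (i : nat) :
  ui_coef (ui_add t u) i = ui_coef t i + ui_coef u i.
Proof. by []. Qed.

Lemma F2_addrr (a : 'F_2) : a + a = 0.
Proof. by case: a => [[|[|//]] ?]; apply/val_inj. Qed.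

Lemma ui_addK (t u : unit_interval) : ui_add t (ui_add t u) = u.
Proof.
by apply: ui_ext => i; rewrite !ui_coef_add addrA F2_addrr add0r.
Qed.

(** [Negz i] is -(i + 1), so c_i becomes the coefficient of T^-(i+1); [rVpoly] supplies zeros past
    the last entry. *)
Definition ui_of_row_coef (N : nat) (c : 'rV['F_2]_N) (n : int) : 'F_2 :=
  if n is Negz i then (rVpoly c)`_i else 0.

Lemma ui_of_row_bounded (N : nat) (c : 'rV['F_2]_N) :
  exists M : int, forall n : int, M < n -> ui_of_row_coef N c n = 0.
Proof. by exists 0 => -[]. Qed.

Lemma ui_of_rowP (N : nat) (c : 'rV['F_2]_N) (n : int) :
  0 <= n -> Laurent (ui_of_row_bounded N c) n = 0.
Proof. by case: n. Qed.

(** The series [c_0 T^-1 + ... + c_(N-1) T^-N]. *)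
Definition ui_of_row (N : nat) (c : 'rV['F_2]_N) : unit_interval :=
  UnitInterval (ui_of_rowP N c).
Arguments ui_of_row {N} c.

Lemma ui_coef_of_row (N : nat) (c : 'rV['F_2]_N) (i : 'I_N) :
  ui_coef (ui_of_row c) i.+1 = c 0 i.
Proof. exact: coef_rVpoly_ord. Qed.

Definition ui_row (N : nat) (t : unit_interval) : 'rV['F_2]_N :=
  \row_(j < N) ui_coef t j.+1.

Lemma ui_of_rowK (N : nat) (c : 'rV['F_2]_N) : ui_row N (ui_of_row c) = c.
Proof. by apply/rowP => i; rewrite mxE ui_coef_of_row. Qed.

Lemma ui_row_add (N : nat) (t u : unit_interval) :
  ui_row N (ui_add t u) = ui_row N t + ui_row N u.
Proof. by apply/rowP => i; rewrite !mxE ui_coef_add. Qed.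

Lemma ui_coef_trunc (N i : nat) (t : unit_interval) : (i < N)%N ->
  ui_coef (ui_of_row (ui_row N t)) i.+1 = ui_coef t i.+1.
Proof.
by move=> iN; rewrite (ui_coef_of_row N _ (Ordinal iN)) mxE.
Qed.

Definition ui_cylinder (N : nat) (c : 'rV['F_2]_N) : set borel_ui :=
  ui_row N @^-1` [set c].
Arguments ui_cylinder {N} c.

Lemma measurable_ui_cylinder (N : nat) (c : 'rV['F_2]_N) :
  measurable (ui_cylinder c).
Proof.
suff: ui_open (ui_cylinder c) by exact: sub_sigma_algebra.
move=> t <-; exists N => u ut.
by apply/rowP => i; rewrite !mxE; exact: ut.
Qed.

(** Translation by [ui_of_row b] carries the cylinder of 0 onto that of b, and the 2^N cylinders
    partition a space of mass 1. *)
Lemma haar_ui_cylinder (R : realType) (mu : {measure set borel_ui -> \bar R})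
    (N : nat) (c : 'rV['F_2]_N) :
  is_haar mu -> mu (ui_cylinder c) = ((2%:R ^+ N)^-1)%:E.
Proof.
move=> [mu1 muD].
have cyl0 (b : 'rV['F_2]_N) : mu (ui_cylinder b) = mu (ui_cylinder (0 : 'rV_N)).
  rewrite -(muD (ui_of_row b) (ui_cylinder 0)); last exact: measurable_ui_cylinder.
  congr (mu _); apply/seteqP; split=> [t tb|_ [t t0 <-]].
    exists (ui_add (ui_of_row b) t); last exact: ui_addK.
    rewrite /ui_cylinder /= ui_row_add ui_of_rowK tb.
    by apply/rowP => i; rewrite !mxE F2_addrr.
  by rewrite /ui_cylinder /= ui_row_add ui_of_rowK t0 addr0.
have : mu (\bigcup_(b in [set: 'rV['F_2]_N]) ui_cylinder b) = 1%E.
  rewrite -mu1; congr (mu _); apply/seteqP; split=> // t _.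
  by exists (ui_row N t).
rewrite measure_fin_bigcup; first last.
- by move=> b _; exact: measurable_ui_cylinder.
- exact: trivIset_preimage1.
- exact: finite_finset.
rewrite (eq_fsbigr (fun=> mu (ui_cylinder (0 : 'rV['F_2]_N)))); last first.
  by move=> b _; exact: cyl0.
(* Finiteness lets the equation 2^N x = 1 be solved in R. *)
rewrite cyl0; have : mu (ui_cylinder (0 : 'rV['F_2]_N)) \is a fin_num.
  rewrite ge0_fin_numE// (@le_lt_trans _ _ 1%E) ?ltry// -mu1.
  by rewrite le_measure ?inE//; exact: measurable_ui_cylinder.
rewrite (@fsbigE _ _ _ _ _ (index_enum _)) ?index_enum_uniq//; last first.
  by move=> b _; rewrite mem_index_enum.
move=> /fineK <-; under eq_bigl do rewrite in_setT.
rewrite sumEFin sumr_const card_mx card_Fp// mul1n -[_ *+ _]mulr_natr natrX.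
move=> [xN]; congr EFin; apply: (mulIf (_ : 2%:R ^+ N != 0)).
  by rewrite expf_neq0 ?pnatr_eq0.
by rewrite xN mulVf// expf_neq0 ?pnatr_eq0.
Qed.

(** A function of the first N digits is a finite combination of indicators of cylinders; this also
    settles its measurability. *)
Lemma integral_ui_row (R : realType) (mu : {measure set borel_ui -> \bar R})
    (N : nat) (h : unit_interval -> R) :
  is_haar mu -> (forall t, 0 <= h t) ->
  (forall t, h t = h (ui_of_row (ui_row N t))) ->
  (\int[mu]_(t in [set: borel_ui]) (h t)%:E =
   ((2%:R ^+ N)^-1 * \sum_(c : 'rV['F_2]_N) h (ui_of_row c))%:E)%E.
Proof.
move=> haar_mu h0 hN.
transitivity (\int[mu]_(t in [set: borel_ui]) (\sum_(c : 'rV['F_2]_N)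
    (h (ui_of_row c))%:E * (\1_(ui_cylinder c) t)%:E))%E.
  apply: eq_integral => t _; rewrite (bigD1 (ui_row N t))//= big1 ?adde0.
    by rewrite indicE mem_set// mule1 -hN.
  move=> c ct; rewrite indicE memNset ?mule0// => tc.
  by case/eqP: ct; rewrite -tc.
have mind (c : 'rV['F_2]_N) :
    measurable_fun [set: borel_ui] (EFin \o (\1_(ui_cylinder c) : borel_ui -> R)).
  apply/measurable_EFinP; apply: measurable_indic.
  exact: measurable_ui_cylinder.
rewrite ge0_integral_sum//; last 2 first.
- by move=> c; apply: measurable_funeM; exact: mind.
- by move=> c t _; rewrite mule_ge0 ?lee_fin.
rewrite mulr_sumr -sumEFin; apply: eq_bigr => c _.
rewrite ge0_integralZl_EFin//; last exact: mind.
rewrite integral_indic//; last exact: measurable_ui_cylinder.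
by rewrite setIT haar_ui_cylinder// -EFinM mulrC.
Qed.

(** * From digit vectors to matrices grouped by rank *)

Lemma Dmx_trunc (m k : nat) (t eta : unit_interval) :
  Dmx m k (ui_of_row (ui_row (k + m) t)) (ui_of_row (ui_row k eta)) =
  Dmx m k t eta.
Proof.
congr col_mx; apply/matrixP => i j; rewrite !mxE ui_coef_trunc//.
by have := ltn_ord i; have := ltn_ord j; lia.
Qed.

Lemma persymmetric_Dmx (m k : nat) (t eta : unit_interval) :
  persymmetric (usubmx (Dmx m k t eta)).
Proof.
apply/forallP => i; apply/forallP => j; apply/forallP => i'; apply/forallP => j'.
by apply/implyP => /eqP ij; rewrite col_mxKu !mxE ij.
Qed.

(** A persymmetric block is determined by its k + m antidiagonals, one per digit of t. For k = 0 the
    empty block would be hit by all 2^m vectors, whence 1 <= k. *)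
Lemma sum_Dmx (V : nmodType) (m k : nat) (g : 'M['F_2]_(m.+1 + 1, k) -> V) :
  (1 <= k)%N ->
  \sum_(b : 'rV['F_2]_k) \sum_(a : 'rV['F_2]_(k + m))
    g (Dmx m k (ui_of_row a) (ui_of_row b)) =
  \sum_(A : 'M['F_2]_(m.+1 + 1, k) | persymmetric (usubmx A)) g A.
Proof.
case: k g => // k g _.
(* The n-th antidiagonal of an (m+1) x (k+1) matrix meets row [minn n m]. *)
pose antidiag (A : 'M['F_2]_(m.+1 + 1, k.+1)) : 'rV['F_2]_(k.+1 + m) :=
  \row_n usubmx A (inord (minn n m)) (inord (n - minn n m)).
rewrite pair_big /= [RHS](reindex_onto
  (fun ba : 'rV['F_2]_k.+1 * 'rV['F_2]_(k.+1 + m) =>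
     Dmx m k.+1 (ui_of_row ba.2) (ui_of_row ba.1))
  (fun A => (dsubmx A, antidiag A))) /=.
  apply: eq_bigl => -[b a]; rewrite persymmetric_Dmx /=; apply/esym/eqP.
  congr (_, _); rewrite /antidiag ?col_mxKd ?col_mxKu; apply/rowP => n.
    by rewrite mxE ui_coef_of_row.
  (* With k + 1 columns, n <= k + m gives n - min(n, m) <= k, so [inord] does not fall back on its
     default. *)
  rewrite !mxE !inordK ?ltnS ?geq_minr//; last first.
    by have := ltn_ord n; lia.
  by rewrite subnKC ?geq_minl// ui_coef_of_row.
move=> A pA; rewrite -[RHS]vsubmxK; congr col_mx; apply/matrixP => i j.
  rewrite mxE.
  have ijk : (i + j < k.+1 + m)%N by have := ltn_ord i; have := ltn_ord j; lia.
  rewrite (ui_coef_of_row _ _ (Ordinal ijk)) mxE /=.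
  (* Persymmetry equates the entry (i, j) with the chosen entry of its antidiagonal. *)
  move/forallP: pA => /(_ (inord (minn (i + j) m))) /forallP.
  move=> /(_ (inord (i + j - minn (i + j) m))) /forallP /(_ i) /forallP /(_ j).
  move=> /implyP H; apply/eqP/H/eqP.
  rewrite !inordK ?ltnS ?geq_minr ?subnKC ?geq_minl//.
  by have := ltn_ord i; have := ltn_ord j; lia.
by rewrite mxE ui_coef_of_row (ord1 i).
Qed.

Lemma sum_persymmetric_rank (R : realType) (m k : nat) (g : nat -> R) :
  \sum_(A : 'M['F_2]_(m.+1 + 1, k) | persymmetric (usubmx A)) g (\rank A) =
  \sum_(0 <= i < (minn k (2 + m)).+1) (Gamma m k i)%:R * g i.
Proof.
have rkA (A : 'M['F_2]_(m.+1 + 1, k)) : (\rank A < (minn k (2 + m)).+1)%N.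
  rewrite ltnS leq_min rank_leq_col (leq_trans (rank_leq_row A))//.
  by rewrite addn1 add2n.
rewrite (partition_big (fun A => Ordinal (rkA A)) predT)//= big_mkord.
apply: eq_bigr => i _; rewrite mulr_natl -sumr_const.
apply: eq_big => [A|A /andP[_ /eqP <-]//].
by rewrite inE -val_eqE.
Qed.

Theorem theorem1p7 (R : realType) (k m q : nat)
    (mu : {measure set borel_ui -> \bar R}) :
  (1 <= k)%N -> (1 <= q)%N -> is_haar mu ->
  (forall t eta : unit_interval,
     fsum R m k t eta = 2%:R ^ ((k + m + 2)%:Z - (\rank (Dmx m k t eta))%:Z)) /\
  (\int[mu]_(eta in [set: borel_ui]) \int[mu]_(t in [set: borel_ui])
      (fsum R m k t eta ^+ q)%:E)%E =
  (2%:R ^ ((q * (k + m + 2))%:Z - (2 * k)%:Z - m%:Z) *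
   \sum_(0 <= i < (minn k (2 + m)).+1)
      (Gamma m k i)%:R * 2%:R ^ (- (i * q)%:Z))%:E.
Proof.
move=> k1 _ haar_mu; split; first exact: fsum_rank.
pose g (i : nat) : R := (2%:R ^ ((k + m + 2)%:Z - i%:Z)) ^+ q.
have g0 i : 0 <= g i by rewrite exprn_ge0// exprz_ge0.
have fE t eta : fsum R m k t eta ^+ q = g (\rank (Dmx m k t eta)).
  by rewrite fsum_rank.
have f_trunc t eta : fsum R m k t eta ^+ q =
    fsum R m k (ui_of_row (ui_row (k + m) t)) (ui_of_row (ui_row k eta)) ^+ q.
  by rewrite !fE Dmx_trunc.
under eq_integral => eta _.
  rewrite (integral_ui_row _ _ (k + m) (fun t => fsum R m k t eta ^+ q))//.
  - over.
  - by move=> t; rewrite fE; exact: g0.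
  (* Truncating both sides suffices, as truncation is idempotent. *)
  - by move=> t; rewrite f_trunc [RHS]f_trunc !ui_of_rowK.
(* The average over t still depends only on the first k digits of eta. *)
rewrite (integral_ui_row _ _ k
  (fun eta => (2%:R ^+ (k + m))^-1 *
     \sum_(c : 'rV['F_2]_(k + m)) fsum R m k (ui_of_row c) eta ^+ q))//;
  last 2 first.
- move=> eta; rewrite mulr_ge0 ?invr_ge0 ?exprn_ge0// sumr_ge0// => c _.
  by rewrite fE; exact: g0.
- move=> eta; congr (_ * _); apply: eq_bigr => c _.
  by rewrite f_trunc [RHS]f_trunc !ui_of_rowK.
congr EFin; rewrite -mulr_sumr mulrA.
under eq_bigr do under eq_bigr do rewrite fE.
rewrite (sum_Dmx _ _ _ (fun A => g (\rank A)))// sum_persymmetric_rank.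
rewrite !mulr_sumr; apply: eq_bigr => i _; rewrite mulrCA [RHS]mulrCA.
have n2 : (2%:R : R) != 0 by rewrite pnatr_eq0.
(* The exponents agree: -k - (k + m) + q(k + m + 2 - i) = q(k + m + 2) - 2k - m - iq. *)
congr (_ * _); rewrite /g !exprnN [X in _ * X = _]exprnP exprz_exp.
by rewrite -!expfzDr//; congr (2%:R ^ _); lia.
Qed.
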